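(* Let $(G,\Gamma,p_t,\pi_t)$, $t\in(-\epsilon,\epsilon)$, be a one-parameter deformation of a periodic framework in $\mathbb{R}^d$. If the path is expansive, that is, if the distance between any pair of vertices increases or stays the same for increasing $t$, then the path is also auxetic. However, auxetic paths need not be expansive (there exist auxetic one-parameter deformations of periodic frameworks that are not expansive).
   Context: A periodic framework $(G,\Gamma,p,\pi)$ in $\mathbb{R}^d$ consists of: an infinite, simple, connected graph $G=(V,E)$; a periodicity group $\Gamma\subset\mathrm{Aut}(G)$, free Abelian of rank $d$, acting without fixed vertices or fixed edges and with finitely many vertex orbits and edge orbits; a placement $p:V\to\mathbb{R}^d$ with $p(u)\neq p(v)$ for $\{u,v\}\in E$; and an injective homomorphism $\pi:\Gamma\to\mathcal{T}(\mathbb{R}^d)\cong\mathbb{R}^d$ into the group of translations, whose image is a lattice of rank $d$, with $p(\gamma v)=p(v)+\pi(\gamma)$ for all $\gamma\in\Gamma$, $v\in V$. A one-parameter deformation is a differentiable family $(G,\Gamma,p_t,\pi_t)$ of periodic frameworks with the same $(G,\Gamma)$ such that all edge lengths are constant in $t$; the lattices $\pi_t(\Gamma)$ may vary with $t$. For $t_1<t_2$ let $T_{t_2t_1}:\mathbb{R}^d\to\mathbb{R}^d$ be the unique linear operator with $\pi_{t_1}=T_{t_2t_1}\circ\pi_{t_2}$ (identifying translations with vectors of $\mathbb{R}^d$). The deformation is called an auxetic path if for any $t_1<t_2$ the operator $T_{t_2t_1}$ is a contraction, i.e. $\|T_{t_2t_1}\|=\sup_{|x|\le1}|T_{t_2t_1}x|\le1$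 for the standard Euclidean norm. *)

(* Defs.v *)
(* MathComp-Analysis. *)
From Stdlib Require Relation_Operators.
From mathcomp Require Export all_boot all_order all_algebra.
From mathcomp Require Export all_classical all_reals all_analysis.
Export Order.TTheory GRing.Theory Num.Theory.
Export numFieldNormedType.Exports.

Set Implicit Arguments.
Unset Strict Implicit.
Unset Printing Implicit Defensive.

Local Open Scope classical_set_scope.
Local Open Scope ring_scope.

(* The library norm `|x| on matrices is the max norm, so the Euclidean one is
   defined here. *)
Definition euclid_norm (R : realType) (d : nat) (x : 'cV[R]_d) : R :=
  Num.sqrt (\sum_(i < d) x i 0 ^+ 2).

Definition euclid_dist (R : realType) (d : nat) (x y : 'cV[R]_d) : R :=
  euclid_norm (x - y).

(* The supremum is taken in the extended reals, so that no default value of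
   [sup] is involved. *)
Definition operator_norm (R : realType) (d : nat) (T : 'M[R]_d) : \bar R :=
  ereal_sup [set (euclid_norm (T *m x))%:E | x in [set x | euclid_norm x <= 1]].

Definition contraction_operator (R : realType) (d : nat) (T : 'M[R]_d) : Prop :=
  (operator_norm T <= 1%:E)%E.

Definition lattice_of_full_rank (R : realType) (d : nat) (L : set 'cV[R]_d) :
    Prop :=
  exists2 B : 'M[R]_d, B \in unitmx &
    L = [set B *m map_mx intr m | m in [set: 'cV[int]_d]].

Record simple_graph (V : Type) (adj : V -> V -> Prop) : Prop := SimpleGraph {
  adj_sym : forall u v, adj u v -> adj v u;
  adj_irrefl : forall v, ~ adj v v }.

Definition connected_graph (V : Type) (adj : V -> V -> Prop) : Prop :=
  forall u v, Relation_Operators.clos_refl_trans V adj u v.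

Definition edges (V : Type) (adj : V -> V -> Prop) : set (set V) :=
  [set e | exists u v, adj u v /\ e = [set u; v]].

Definition graph_automorphism (V : Type) (adj : V -> V -> Prop) (g : V -> V) :
    Prop :=
  bijective g /\ forall u v, adj (g u) (g v) <-> adj u v.

Record subgroup_of_Aut (V : Type) (adj : V -> V -> Prop)
    (Gamma : set (V -> V)) : Prop := SubgroupOfAut {
  sub_Aut : forall g, Gamma g -> graph_automorphism adj g;
  sub_id : Gamma id;
  sub_comp : forall g h, Gamma g -> Gamma h -> Gamma (g \o h);
  sub_inv : forall g, Gamma g -> exists2 h, Gamma h & cancel g h /\ cancel h g }.

(* [Gamma], under composition, is isomorphic to Z^d. *)
Definition free_abelian_of_rank (V : Type) (Gamma : set (V -> V)) (d : nat) :
    Prop :=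
  exists2 phi : 'cV[int]_d -> (V -> V),
    set_bij [set: 'cV[int]_d] Gamma phi &
    forall m n : 'cV[int]_d, phi (m + n) = phi m \o phi n.

Definition vertex_orbit (V : Type) (Gamma : set (V -> V)) (v : V) : set V :=
  [set g v | g in Gamma].

Definition edge_orbit (V : Type) (Gamma : set (V -> V)) (e : set V) :
    set (set V) :=
  [set g @` e | g in Gamma].

Record periodic_graph (d : nat) (V : Type) (adj : V -> V -> Prop)
    (Gamma : set (V -> V)) : Prop := PeriodicGraph {
  pg_infinite : infinite_set [set: V];
  pg_simple : simple_graph adj;
  pg_connected : connected_graph adj;
  pg_subgroup : subgroup_of_Aut adj Gamma;
  pg_free_abelian : free_abelian_of_rank Gamma d;
  pg_no_fixed_vertex : forall g, Gamma g -> g <> id -> forall v, g v <> v;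
  pg_no_fixed_edge : forall g, Gamma g -> g <> id ->
    forall e, edges adj e -> g @` e <> e;
  pg_finite_vertex_orbits :
    finite_set [set vertex_orbit Gamma v | v in [set: V]];
  pg_finite_edge_orbits :
    finite_set [set edge_orbit Gamma e | e in edges adj] }.

(* A translation of R^d is identified with its vector; [tau] is only
   meaningful on [Gamma]. *)
Record periodic_framework (R : realType) (d : nat) (V : Type)
    (adj : V -> V -> Prop) (Gamma : set (V -> V))
    (p : V -> 'cV[R]_d) (tau : (V -> V) -> 'cV[R]_d) : Prop :=
  PeriodicFramework {
  pf_graph : periodic_graph d adj Gamma;
  pf_edge_neq : forall u v, adj u v -> p u <> p v;
  pf_morph : forall g h, Gamma g -> Gamma h -> tau (g \o h) = tau g + tau h;
  pf_inj : set_inj Gamma tau;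
  pf_lattice : lattice_of_full_rank [set tau g | g in Gamma];
  pf_equivariant : forall g v, Gamma g -> p (g v) = p v + tau g }.

(* The families [p] and [tau] are indexed by all of R, but are only
   constrained for t in ]-eps, eps[. *)
Record one_parameter_deformation (R : realType) (d : nat) (V : Type)
    (adj : V -> V -> Prop) (Gamma : set (V -> V)) (eps : R)
    (p : R -> V -> 'cV[R]_d) (tau : R -> (V -> V) -> 'cV[R]_d) : Prop :=
  OneParameterDeformation {
  opd_framework : forall t : R, t \in `]- eps, eps[ ->
    periodic_framework adj Gamma (p t) (tau t);
  opd_derivable_placement : forall (t : R) (v : V), t \in `]- eps, eps[ ->
    derivable (fun s => p s v) t 1;
  opd_derivable_lattice : forall (t : R) (g : V -> V), t \in `]- eps, eps[ -> Gamma g ->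
    derivable (fun s => tau s g) t 1;
  opd_edge_length : forall (s t : R) (u v : V),
    s \in `]- eps, eps[ -> t \in `]- eps, eps[ -> adj u v ->
    euclid_dist (p s u) (p s v) = euclid_dist (p t u) (p t v) }.

Definition expansive (R : realType) (d : nat) (V : Type) (eps : R)
    (p : R -> V -> 'cV[R]_d) : Prop :=
  forall t1 t2 : R, t1 \in `]- eps, eps[ -> t2 \in `]- eps, eps[ -> t1 < t2 ->
  forall u v, euclid_dist (p t1 u) (p t1 v) <= euclid_dist (p t2 u) (p t2 v).

Definition transition_operator (R : realType) (d : nat) (V : Type)
    (Gamma : set (V -> V)) (tau1 tau2 : (V -> V) -> 'cV[R]_d) (T : 'M[R]_d) :
    Prop :=
  forall g, Gamma g -> tau1 g = T *m tau2 g.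

(* [unique P T] states that T is the one and only element satisfying P. *)
Definition auxetic (R : realType) (d : nat) (V : Type) (Gamma : set (V -> V))
    (eps : R) (tau : R -> (V -> V) -> 'cV[R]_d) : Prop :=
  forall t1 t2 : R, t1 \in `]- eps, eps[ -> t2 \in `]- eps, eps[ -> t1 < t2 ->
  exists2 T : 'M[R]_d, unique (transition_operator Gamma (tau t1) (tau t2)) T &
    contraction_operator T.

(* Main.v *)
Require Import Defs.
From HB Require Import structures.

(** Expansive implies auxetic. A period g moves every vertex v by tau_t g, so
    |tau_t g| is the distance between the vertices v and g v, and expansiveness
    says that it does not decrease with t. In coordinates Gamma = Z^d, the
    periods at time t are the vectors M_t m (m in Z^d) for an invertible real
    matrix M_t ([additive_lattice_mx], [unitmx_of_lattice]); the transition
    operator is T = M_(t1) M_(t2)^-1, and being a contraction means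
    |M_(t1) x| <= |M_(t2) x| for every real vector x. The inequality is known for
    integral x, hence holds for rational x by homogeneity and for real x by
    density ([le_euclid_norm_lattice]). Comparing two lattices by the lengths of
    corresponding periods is the content of [transition_contraction].

    Auxetic does not imply expansive. Contractions of the lattice say nothing
    about the motion inside a unit cell. Take the square grid Z^2 in the plane,
    attach to each grid vertex a pendant edge of length 1, and rotate all the
    pendant edges simultaneously. The lattice of periods stays put, so that all
    transition operators are the identity, but the free end of a pendant edge
    approaches some grid vertices: its distance to the left neighbour of its
    point of attachment falls from 2 to sqrt 2 when the arm turns from the
    positive x-axis to the positive y-axis ([pendant_not_expansive]). *)

Set Implicit Arguments.
Unset Strict Implicit.
Unset Printing Implicit Defensive.

Local Open Scope classical_set_scope.
Local Open Scope ring_scope.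

(** * Euclidean norms on integral and on real vectors *)

Lemma euclid_normN (R : realType) (d : nat) (x : 'cV[R]_d) :
  euclid_norm (- x) = euclid_norm x.
Proof.
by rewrite /euclid_norm; under eq_bigr do rewrite mxE sqrrN.
Qed.

Lemma euclid_normZ (R : realType) (d : nat) (a : R) (x : 'cV[R]_d) :
  euclid_norm (a *: x) = `|a| * euclid_norm x.
Proof.
rewrite /euclid_norm -[`|a|]sqrtr_sqr -sqrtrM ?sqr_ge0// mulr_sumr.
by under eq_bigr do rewrite mxE exprMn.
Qed.

Lemma cvg_euclid_norm (R : realType) (d : nat) (x : nat -> 'cV[R]_d)
    (y : 'cV[R]_d) :
  (forall i, x n i 0 @[n --> \oo] --> y i 0) ->
  euclid_norm (x n) @[n --> \oo] --> euclid_norm y.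
Proof.
move=> xy.
have sum_cvg : \sum_i x n i 0 ^+ 2 @[n --> \oo] --> \sum_i y i 0 ^+ 2.
  apply: cvg_big => [|i _]; first exact: add_continuous.
  exact: (cvg_comp _ _ (xy i) (@exprn_continuous R 2 _)).
exact: (cvg_comp _ _ sum_cvg (@sqrt_continuous R _)).
Qed.

Lemma cvg_floor_div (R : realType) (x : R) :
  n.+1%:R^-1 * (Num.floor (n.+1%:R * x))%:~R @[n --> \oo] --> x.
Proof.
apply: (@squeeze_cvgr _ _ _ _ (fun n => x - harmonic n) (cst x)); last 2 first.
- rewrite -[X in _ --> X]subr0; apply: cvgB; first exact: cvg_cst.
  exact: cvg_harmonic.
- exact: cvg_cst.
apply: nearW => n /=.
have n0 : 0 < n.+1%:R :> R by rewrite ltr0n.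
rewrite /harmonic/= ler_pdivrMl// ler_pdivlMl// floor_le andbT.
rewrite mulrBr mulfV ?gt_eqF// lerBlDr.
by have /andP[_ /ltW] := floor_itv (n.+1%:R * x); rewrite intrD.
Qed.

(** Density of the rational vectors: x is the limit of floor(N x) / N, whose
    numerators are integral, and both sides are continuous and homogeneous. *)
Lemma le_euclid_norm_lattice (R : realType) (d : nat) (A B : 'M[R]_d) :
  (forall m : 'cV[int]_d,
    euclid_norm (A *m map_mx intr m) <= euclid_norm (B *m map_mx intr m)) ->
  forall x : 'cV[R]_d, euclid_norm (A *m x) <= euclid_norm (B *m x).
Proof.
move=> AB x.
pose m n : 'cV[int]_d := map_mx (fun z => Num.floor (n.+1%:R * z)) x.
pose q n : 'cV[R]_d := n.+1%:R^-1 *: map_mx intr (m n).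
have cvgq (C : 'M[R]_d) :
    euclid_norm (C *m q n) @[n --> \oo] --> euclid_norm (C *m x).
  apply: cvg_euclid_norm => i; rewrite mxE.
  under eq_cvg do rewrite mxE.
  apply: cvg_big => [|j _]; first exact: add_continuous.
  apply: cvgM; first exact: cvg_cst.
  by under eq_cvg do rewrite !mxE; exact: cvg_floor_div.
apply: ler_cvg_to (cvgq A) (cvgq B) _.
apply: nearW => n; rewrite -!scalemxAr !euclid_normZ.
by rewrite ler_wpM2l.
Qed.

(** * Lattices of periods in coordinates *)

Lemma mulmx_delta_col (R : realType) (d : nat) (A : 'M[R]_d) (j : 'I_d) :
  A *m map_mx intr (delta_mx j 0 : 'cV[int]_d) = col j A.
Proof. by rewrite map_delta_mx -colE. Qed.

Lemma eq_mulmx_lattice (R : realType) (d : nat) (A B : 'M[R]_d) :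
  (forall m : 'cV[int]_d, A *m map_mx intr m = B *m map_mx intr m) -> A = B.
Proof.
move=> AB; apply/matrixP => i j.
by have /colP/(_ i) := AB (delta_mx j 0); rewrite !mulmx_delta_col !mxE.
Qed.

(** The columns of the matrix are the images of the standard generators of
    Z^d. *)
Lemma additive_lattice_mx (R : realType) (d : nat)
    (f : 'cV[int]_d -> 'cV[R]_d) :
  {morph f : m n / m + n} -> {M : 'M[R]_d | forall m, f m = M *m map_mx intr m}.
Proof.
move=> fD.
have f0 : f 0 = 0 by apply: (addrI (f 0)); rewrite -fD !addr0.
pose F : {additive _ -> _} := HB.pack f
  (GRing.isNmodMorphism.Build _ _ f (conj f0 fD)).
exists (\matrix_(i, j) f (delta_mx j 0) i 0) => m.
rewrite -[f]/(F : _ -> _) {1}[m]matrix_sum_delta raddf_sum.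
apply/colP => i; rewrite summxE !mxE; apply: eq_bigr => j _.
by rewrite big_ord1 -{1}[m j 0]intz scaler_int raddfMz -scaler_int !mxE mulrC.
Qed.

(** Full rank is witnessed by some lattice basis B, a priori unrelated to M; as
    its columns lie in the lattice, B = M N with N integral, and M inherits
    invertibility from B. *)
Lemma unitmx_of_lattice (R : realType) (d : nat) (M : 'M[R]_d) :
  lattice_of_full_rank [set M *m map_mx intr m | m in [set: 'cV[int]_d]] ->
  M \in unitmx.
Proof.
move=> [B Bunit ML].
have /choice[n nE] (j : 'I_d) :
    exists m : 'cV[int]_d, M *m map_mx intr m = col j B.
  have : [set B *m map_mx intr m | m in [set: 'cV[int]_d]] (col j B).
    by exists (delta_mx j 0) => //; rewrite mulmx_delta_col.
  by rewrite -ML => -[m _ <-]; exists m.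
suff BE : B = M *m \matrix_(i, j) (n j i 0)%:~R.
  by move: Bunit; rewrite BE unitmx_mul => /andP[].
apply/matrixP => i j; have /colP/(_ i) := nE j.
by rewrite !mxE => <-; apply: eq_bigr => k _; rewrite !mxE.
Qed.

(** The transition operator is M1 M2^-1, where Mi sends integral coordinates to
    the periods of the i-th framework. It is stated for two frameworks rather
    than for a path so that it yields both the implication from expansive to
    auxetic, where periods get longer, and the auxeticity of the counterexample,
    where they are constant. *)
Lemma transition_contraction (R : realType) (d : nat) (V : Type)
    (adj : V -> V -> Prop) (Gamma : set (V -> V)) (p1 p2 : V -> 'cV[R]_d)
    (tau1 tau2 : (V -> V) -> 'cV[R]_d) :
  periodic_framework adj Gamma p1 tau1 ->
  periodic_framework adj Gamma p2 tau2 ->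
  (forall g, Gamma g -> euclid_norm (tau1 g) <= euclid_norm (tau2 g)) ->
  exists2 T : 'M[R]_d, unique (transition_operator Gamma tau1 tau2) T &
    contraction_operator T.
Proof.
move=> F1 F2 le12.
have [phi phi_bij phiD] := pg_free_abelian (pf_graph F1).
have [phiG _ phi_surj] := phi_bij.
have phiP g : Gamma g -> exists m, phi m = g.
  by move=> /phi_surj[m _ mg]; exists m.
have Gphi m : Gamma (phi m) by exact: phiG.
have period_mx p tau : periodic_framework adj Gamma p tau ->
    exists2 M : 'M[R]_d, M \in unitmx &
      forall m, tau (phi m) = M *m map_mx intr m.
  move=> F.
  have [|M ME] := @additive_lattice_mx R d (tau \o phi).
    by move=> m n; rewrite /= phiD (pf_morph F).
  exists M => //; apply: unitmx_of_lattice.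
  have := pf_lattice F; congr lattice_of_full_rank; apply/seteqP; split => x /=.
    by move=> [g /phiP[m <-] <-]; exists m; rewrite // -ME.
  by move=> [m _ <-]; exists (phi m); rewrite // -ME.
have [M1 M1unit M1E] := period_mx _ _ F1.
have [M2 M2unit M2E] := period_mx _ _ F2.
exists (M1 *m invmx M2).
  split=> [g /phiP[m <-]|T TE].
    by rewrite M1E M2E -mulmxA mulKmx.
  have <- : T *m M2 = M1.
    by apply: eq_mulmx_lattice => m; rewrite -mulmxA -M2E -M1E -TE.
  by rewrite mulmxK.
apply: ge_ereal_sup => _ [x /= x1 <-]; rewrite lee_fin.
apply: le_trans x1; rewrite -mulmxA -[in leRHS](mulKVmx M2unit x).
apply: le_euclid_norm_lattice => m.
by rewrite -M1E -M2E le12.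
Qed.

Lemma expansive_auxetic (R : realType) (d : nat) (V : Type)
    (adj : V -> V -> Prop) (Gamma : set (V -> V)) (eps : R)
    (p : R -> V -> 'cV[R]_d) (tau : R -> (V -> V) -> 'cV[R]_d) :
  one_parameter_deformation adj Gamma eps p tau ->
  expansive eps p -> auxetic Gamma eps tau.
Proof.
move=> D E t1 t2 t1e t2e t12.
have F1 := opd_framework D t1e; have F2 := opd_framework D t2e.
apply: (transition_contraction F1 F2) => g Gg.
have [v _] := infinite_setN0 (pg_infinite (pf_graph F1)).
have := E _ _ t1e t2e t12 (g v) v.
by rewrite /euclid_dist (pf_equivariant F1)// (pf_equivariant F2)// ![p _ v + _]addrC !addrK.
Qed.

(** * The grid with pendant edges *)

(** The vertex (m, false) is the grid point m, and (m, true) is the free end of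
    the pendant edge attached to it. *)
Definition pvertex (d : nat) : Type := 'cV[int]_d * bool.

Inductive pendant_adj (d : nat) : pvertex d -> pvertex d -> Prop :=
| grid_edge m i : pendant_adj (m, false) (m + delta_mx i 0, false)
| grid_edge_rev m i : pendant_adj (m + delta_mx i 0, false) (m, false)
| pendant_edge m b : pendant_adj (m, b) (m, ~~ b).

Definition shift_vertex (d : nat) (m : 'cV[int]_d) (u : pvertex d) :
  pvertex d := (m + u.1, u.2).

Definition shifts (d : nat) : set (pvertex d -> pvertex d) :=
  range (@shift_vertex d).

Lemma shift_vertex0 (d : nat) : shift_vertex (0 : 'cV[int]_d) = id.
Proof. by apply/funext => -[m b]; rewrite /shift_vertex add0r. Qed.

Lemma shift_vertexD (d : nat) (m n : 'cV[int]_d) :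
  shift_vertex (m + n) = shift_vertex m \o shift_vertex n.
Proof. by apply/funext => u; rewrite /shift_vertex /= addrA. Qed.

Lemma shift_vertexK (d : nat) (m : 'cV[int]_d) :
  cancel (shift_vertex m) (shift_vertex (- m)).
Proof. by move=> [n b]; rewrite /shift_vertex /= addKr. Qed.

Lemma shift_vertexNK (d : nat) (m : 'cV[int]_d) :
  cancel (shift_vertex (- m)) (shift_vertex m).
Proof. by move=> [n b]; rewrite /shift_vertex /= addNKr. Qed.

Lemma shift_vertex_inj (d : nat) : injective (@shift_vertex d).
Proof.
by move=> m n /(congr1 (fun g => (g (0, false)).1)); rewrite /= !addr0.
Qed.

Lemma pendant_adj_sym (d : nat) (u v : pvertex d) :
  pendant_adj u v -> pendant_adj v u.
Proof.
case=> [m i|m i|m b]; first exact: grid_edge_rev; first exact: grid_edge.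
by rewrite -{2}[b]negbK; exact: pendant_edge.
Qed.

Lemma pendant_adj_shift (d : nat) (m : 'cV[int]_d) (u v : pvertex d) :
  pendant_adj u v -> pendant_adj (shift_vertex m u) (shift_vertex m v).
Proof.
case=> [n i|n i|n b]; rewrite /shift_vertex /=.
- by rewrite addrA; exact: grid_edge.
- by rewrite addrA; exact: grid_edge_rev.
- exact: pendant_edge.
Qed.

Lemma pendant_adj_neq (d : nat) (u v : pvertex d) : pendant_adj u v -> u <> v.
Proof.
have e_neq0 (m : 'cV[int]_d) i : m + delta_mx i 0 <> m.
  move=> /(congr1 (fun x => (x - m) i 0)).
  by rewrite addrAC subrr add0r !mxE !eqxx.
case=> [m i|m i|m b] [].
- by move/esym/e_neq0.
- by move/e_neq0.
- by case: b.
Qed.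

Lemma shift_pendant_automorphism (d : nat) (m : 'cV[int]_d) :
  graph_automorphism (@pendant_adj d) (shift_vertex m).
Proof.
split=> [|u v].
  by exists (shift_vertex (- m)); [exact: shift_vertexK|exact: shift_vertexNK].
split; last exact: pendant_adj_shift.
by move=> /(pendant_adj_shift (- m)); rewrite !shift_vertexK.
Qed.

Lemma shifts_subgroup (d : nat) :
  subgroup_of_Aut (@pendant_adj d) (@shifts d).
Proof.
split.
- by move=> _ [m _ <-]; exact: shift_pendant_automorphism.
- by exists 0 => //; exact: shift_vertex0.
- by move=> _ _ [m _ <-] [n _ <-]; exists (m + n); rewrite ?shift_vertexD.
- move=> _ [m _ <-]; exists (shift_vertex (- m)); first by exists (- m).
  by split; [exact: shift_vertexK|exact: shift_vertexNK].
Qed.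

Lemma shifts_free_abelian (d : nat) : free_abelian_of_rank (@shifts d) d.
Proof.
exists (@shift_vertex d); last exact: shift_vertexD.
split=> [m _|m n _ _ /shift_vertex_inj//|//]; by exists m.
Qed.

Lemma shift_vertex_fix (d : nat) (m : 'cV[int]_d) (u : pvertex d) :
  shift_vertex m u = u -> shift_vertex m = id.
Proof.
move=> /(congr1 fst) /= mu; have -> : m = 0 by apply: (addIr u.1); rewrite mu add0r.
exact: shift_vertex0.
Qed.

(** A shift that preserves an edge either fixes an end or swaps the ends; in the
    latter case its square fixes both, and Z^d has no element of order two. *)
Lemma shift_vertex_fix_edge (d : nat) (m : 'cV[int]_d) (u v : pvertex d) :
  shift_vertex m @` [set u; v] = [set u; v] -> shift_vertex m = id.
Proof.
move=> E.
have im x : [set u; v] x -> [set u; v] (shift_vertex m x).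
  by move=> xuv; rewrite -E; exists x.
have [/shift_vertex_fix//|mu] := im u (or_introl erefl).
have [mv|/shift_vertex_fix//] := im v (or_intror erefl).
have /shift_vertex_fix : shift_vertex (m + m) u = u.
  by rewrite shift_vertexD /= mu mv.
rewrite -shift_vertex0 => /shift_vertex_inj mm0.
suff -> : m = 0 by [].
apply/colP => i; have /colP/(_ i) := mm0; rewrite !mxE => /eqP.
by rewrite -mulr2n mulrn_eq0 => /eqP.
Qed.

Lemma vertex_orbit_shift (d : nat) (m : 'cV[int]_d) (u : pvertex d) :
  vertex_orbit (@shifts d) (shift_vertex m u) = vertex_orbit (@shifts d) u.
Proof.
apply/seteqP; split=> [_ [_ [n _ <-] <-]|_ [_ [n _ <-] <-]].
  by exists (shift_vertex (n + m)); [exists (n + m)|rewrite shift_vertexD].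
exists (shift_vertex (n - m)); first by exists (n - m).
by rewrite shift_vertexD /= shift_vertexK.
Qed.

Lemma edge_orbit_shift (d : nat) (m : 'cV[int]_d) (e : set (pvertex d)) :
  edge_orbit (@shifts d) (shift_vertex m @` e) = edge_orbit (@shifts d) e.
Proof.
apply/seteqP; split=> [_ [_ [n _ <-] <-]|_ [_ [n _ <-] <-]].
  exists (shift_vertex (n + m)); first by exists (n + m).
  by rewrite shift_vertexD image_comp.
exists (shift_vertex (n - m)); first by exists (n - m).
rewrite image_comp -shift_vertexD subrK//.
Qed.

Lemma pendant_finite_vertex_orbits (d : nat) :
  finite_set [set vertex_orbit (@shifts d) v | v in [set: pvertex d]].
Proof.
have : finite_set
    [set vertex_orbit (@shifts d) (0 : 'cV[int]_d, b) | b in [set: bool]].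
  by apply: finite_image; exact: finite_finset.
apply: sub_finite_set => _ [[m b] _ <-]; exists b => //.
by rewrite -(vertex_orbit_shift m) /shift_vertex /= addr0.
Qed.

(** Each edge is a shift of the pendant edge at the origin or of one of the d
    grid edges that leave the origin in a coordinate direction. *)
Lemma pendant_finite_edge_orbits (d : nat) :
  finite_set [set edge_orbit (@shifts d) e | e in edges (@pendant_adj d)].
Proof.
pose rep (c : option 'I_d) : set (pvertex d) :=
  if c is Some i then [set (0, false); (delta_mx i 0, false)]
  else [set (0, false); (0, true)].
have : finite_set [set edge_orbit (@shifts d) (rep c) | c in setT].
  by apply: finite_image; exact: finite_finset.
apply: sub_finite_set => _ [_ [u [v [uv ->]]] <-].
suff [m [c ->]] : exists m c, [set u; v] = shift_vertex m @` rep c.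
  by exists c; rewrite // edge_orbit_shift.
have repE m c : shift_vertex m @` rep c =
    if c is Some i then [set (m, false); (m + delta_mx i 0, false)]
    else [set (m, false); (m, true)].
  by case: c => [i|]; rewrite image_setU !image_set1 /shift_vertex /= addr0.
case: uv => [m i|m i|m b]; exists m.
- by exists (Some i); rewrite repE.
- by exists (Some i); rewrite repE setUC.
- by exists None; rewrite repE; case: b; rewrite // setUC.
Qed.

(** By shift invariance, the grid points that can be reached from the origin form
    a subgroup of Z^d; it contains the standard generators. *)
Lemma pendant_connected (d : nat) : connected_graph (@pendant_adj d).
Proof.
pose reach := Relation_Operators.clos_refl_trans (pvertex d) (@pendant_adj d).
have reach_trans u v w : reach u v -> reach v w -> reach u w.
  exact: Relation_Operators.rt_trans.
have reach_sym u v : reach u v -> reach v u.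
  elim=> [x y /pendant_adj_sym|x|x y z _ yx _ zy].
  - exact: Relation_Operators.rt_step.
  - exact: Relation_Operators.rt_refl.
  - exact: reach_trans zy yx.
have reach_shift m u v :
    reach u v -> reach (shift_vertex m u) (shift_vertex m v).
  elim=> [x y /(pendant_adj_shift m)|x|x y z _ xy _ yz].
  - exact: Relation_Operators.rt_step.
  - exact: Relation_Operators.rt_refl.
  - exact: reach_trans xy yz.
pose H (m : 'cV[int]_d) := reach (0, false) (m, false).
have H0 : H 0 by exact: Relation_Operators.rt_refl.
have HD m n : H m -> H n -> H (m + n).
  move=> Hm /(reach_shift m); rewrite /shift_vertex /= addr0.
  exact: reach_trans.
have HN m : H m -> H (- m).
  move=> /(reach_shift (- m)); rewrite /shift_vertex /= addr0 addNr.
  exact: reach_sym.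
have He i : H (delta_mx i 0).
  by apply: Relation_Operators.rt_step; rewrite -[delta_mx i 0]add0r; exact: grid_edge.
have HMn m k : H m -> H (m *+ k).
  by move=> Hm; elim: k => [|k IH]; rewrite ?mulr0n ?mulrS//; exact: HD.
have HMz m (z : int) : H m -> H (m *~ z).
  by case: z => k Hm; [|apply: HN]; exact: HMn.
have HT m : H m.
  rewrite [m]matrix_sum_delta.
  apply: (big_ind H) => // i _; rewrite big_ord1 -[m i ord0]intz scaler_int.
  exact/HMz/He.
have to_grid m b : reach (m, b) (m, false).
  case: b; last exact: Relation_Operators.rt_refl.
  by apply: Relation_Operators.rt_step; exact: (pendant_edge m true).
move=> [m a] [n b].
apply: (reach_trans _ _ _ (to_grid m a)).
apply: (reach_trans _ _ _ (reach_sym _ _ (HT m))).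
exact: reach_trans (HT n) (reach_sym _ _ (to_grid n b)).
Qed.

(** In dimension 0 there are only two vertices, hence the successor. *)
Lemma pendant_infinite (d : nat) : infinite_set [set: pvertex d.+1].
Proof.
pose f (k : nat) : pvertex d.+1 := (const_mx k%:Z, false).
have f_inj : injective f.
  by move=> k l [] /(congr1 (fun x : 'cV_d.+1 => x 0 0)); rewrite !mxE => -[].
move=> fin; apply: infinite_nat; rewrite -(preimage_setT f).
by apply: finite_preimage fin => k l _ _; exact: f_inj.
Qed.

Lemma pendant_periodic_graph (d : nat) :
  periodic_graph d.+1 (@pendant_adj d.+1) (@shifts d.+1).
Proof.
split.
- exact: pendant_infinite.
- split; first exact: pendant_adj_sym.
  by move=> v /pendant_adj_neq.
- exact: pendant_connected.
- exact: shifts_subgroup.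
- exact: shifts_free_abelian.
- by move=> _ [m _ <-] mid v /shift_vertex_fix.
- move=> _ [m _ <-] mid _ [u [v [_ ->]]] /shift_vertex_fix_edge; exact: mid.
- exact: pendant_finite_vertex_orbits.
- exact: pendant_finite_edge_orbits.
Qed.

(** * Rotating the pendant edges *)

Definition unit_arm (R : realType) (t : R) : 'cV[R]_2 :=
  \col_(i < 2) (if i == 0 then cos t else sin t).

Definition pendant_placement (R : realType) (t : R) (u : pvertex 2) :
  'cV[R]_2 := map_mx intr u.1 + (u.2 : nat)%:R *: unit_arm t.

(** The period is read off from where g sends the origin of the grid, which makes
    it a function of g rather than of the vector of the shift. *)
Definition shift_period (R : realType) (g : pvertex 2 -> pvertex 2) :
  'cV[R]_2 := map_mx intr (g (0, false)).1.

Lemma shift_periodE (R : realType) (m : 'cV[int]_2) :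
  shift_period R (shift_vertex m) = map_mx intr m.
Proof. by rewrite /shift_period /= addr0. Qed.

(** As all edges have length 1 at all times, this gives at once that edge lengths
    are constant and that edges do not degenerate. *)
Lemma pendant_unit_edges (R : realType) (t : R) (u v : pvertex 2) :
  pendant_adj u v ->
  euclid_dist (pendant_placement t u) (pendant_placement t v) = 1.
Proof.
have normE (i : 'I_2) :
    euclid_norm (map_mx intr (delta_mx i 0 : 'cV[int]_2) : 'cV[R]_2) = 1.
  rewrite /euclid_norm (bigD1 i)//= big1 => [|j /negPf ji].
    by rewrite !mxE !eqxx addr0 expr1n sqrtr1.
  by rewrite !mxE ji expr0n.
have norm_arm : euclid_norm (unit_arm t) = 1.
  by rewrite /euclid_norm !big_ord_recl big_ord0 !mxE /= addr0 cos2Dsin2 sqrtr1.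
case=> [m i|m i|m b]; rewrite /euclid_dist /pendant_placement /=.
- by rewrite !scale0r !addr0 map_mxD opprD addNKr euclid_normN.
- by rewrite !scale0r !addr0 map_mxD addrAC subrr add0r.
- rewrite opprD addrACA subrr add0r -scalerBl euclid_normZ norm_arm mulr1.
  by case: b; rewrite ?subr0 ?sub0r ?normrN normr1.
Qed.

Lemma pendant_framework (R : realType) (t : R) :
  periodic_framework (@pendant_adj 2) (@shifts 2) (pendant_placement t)
    (@shift_period R).
Proof.
split.
- exact: pendant_periodic_graph.
- move=> u v /(pendant_unit_edges t) + puv; rewrite puv /euclid_dist subrr.
  by rewrite -(scale0r 0) euclid_normZ normr0 mul0r => /eqP; rewrite eq_sym oner_eq0.
- move=> _ _ [m _ <-] [n _ <-].
  by rewrite -shift_vertexD !shift_periodE map_mxD.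
- move=> _ _ /set_mem[m _ <-] /set_mem[n _ <-]; rewrite !shift_periodE.
  move=> mn; congr shift_vertex; apply/colP => i.
  by have /colP/(_ i) := mn; rewrite !mxE => /intr_inj.
- exists 1%:M; first exact: unitmx1.
  apply/seteqP; split=> [_ [_ [m _ <-] <-]|_ [m _ <-]].
    by exists m; rewrite // mul1mx shift_periodE.
  by exists (shift_vertex m); [exists m|rewrite mul1mx shift_periodE].
- move=> _ u [m _ <-]; rewrite shift_periodE /pendant_placement /= map_mxD.
  by rewrite -addrA addrC.
Qed.

Lemma pendant_deformation (R : realType) (eps : R) :
  one_parameter_deformation (@pendant_adj 2) (@shifts 2) eps
    (@pendant_placement R) (fun _ => @shift_period R).
Proof.
split.
- by move=> t _; exact: pendant_framework.
- move=> t u _; apply/derivable_mxP => i j.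
  under [X in derivable X _ _]eq_fun do rewrite !mxE.
  apply: derivableD; first exact: derivable_cst.
  by apply: derivableZ; case: eqP => _; [exact: derivable_cos|exact: derivable_sin].
- by move=> t g _ _; exact: derivable_cst.
- by move=> s t u v _ _ uv; rewrite !pendant_unit_edges.
Qed.

Lemma pendant_auxetic (R : realType) (eps : R) :
  auxetic (@shifts 2) eps (fun _ : R => @shift_period R).
Proof.
move=> t1 t2 _ _ _.
exact: transition_contraction (pendant_framework t1) (pendant_framework t2) _.
Qed.

(** The free end of the pendant edge at the origin sits at (1, 0) for t = 0 and
    at (0, 1) for t = pi / 2; seen from (-1, 0), it has come closer. *)
Lemma pendant_not_expansive (R : realType) :
  ~ expansive pi (@pendant_placement R).
Proof.
have pi0 := pi_gt0 R.
have dE t : euclid_dist (pendant_placement t (0, true))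
    (pendant_placement t (- delta_mx 0 0, false)) =
    Num.sqrt ((cos t + 1) ^+ 2 + sin t ^+ 2).
  rewrite /euclid_dist /euclid_norm !big_ord_recl big_ord0 !mxE /=.
  by rewrite !mul1r !mul0r !addr0 add0r opprK add0r oppr0 addr0.
have pihalf : 0 < pi / 2 :> R by rewrite divr_gt0.
move=> /(_ 0 (pi / 2)); rewrite !in_itv /= oppr_lt0 pi0 pihalf.
have -> : - pi < pi / 2 :> R by rewrite (lt_trans _ pihalf)// oppr_lt0.
have -> : pi / 2 < pi :> R by rewrite ltr_pdivrMr// ltr_pMr// ltr1n.
move=> /(_ isT isT isT (0, true) (- delta_mx 0 0, false)).
rewrite !dE cos0 sin0 cos_pihalf sin_pihalf ler_sqrt.
  rewrite add0r expr0n addr0 !expr1n.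
  by rewrite -[1 + 1]/2%:R -natrX ler_nat.
by rewrite addr_ge0// sqr_ge0.
Qed.

Theorem theorem17 (R : realType) :
  (forall (d : nat) (V : Type) (adj : V -> V -> Prop) (Gamma : set (V -> V))
      (eps : R) (p : R -> V -> 'cV[R]_d) (tau : R -> (V -> V) -> 'cV[R]_d),
    0 < eps ->
    one_parameter_deformation adj Gamma eps p tau ->
    expansive eps p ->
    auxetic Gamma eps tau) /\
  (exists (d : nat) (V : Type) (adj : V -> V -> Prop) (Gamma : set (V -> V))
      (eps : R) (p : R -> V -> 'cV[R]_d) (tau : R -> (V -> V) -> 'cV[R]_d),
    [/\ 0 < eps,
        one_parameter_deformation adj Gamma eps p tau,
        auxetic Gamma eps tau &
        ~ expansive eps p]).
Proof.
split=> [d V adj Gamma eps p tau _|]; first exact: expansive_auxetic.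
exists 2, (pvertex 2), (@pendant_adj 2), (@shifts 2), pi.
exists (@pendant_placement R), (fun _ => @shift_period R); split.
- exact: pi_gt0.
- exact: pendant_deformation.
- exact: pendant_auxetic.
- exact: pendant_not_expansive.
Qed.
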